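(* Let $k, r, \delta$ be integers with $r\ge 2$, $\delta\ge 2$ and $r<k$, and let $\mu = \left\lceil \frac{(k-1)(\delta-1)+1}{(r-1)(\delta-1)+1}\right\rceil -1$. If $n=k(r(\delta-1)+1)$ and $q$ is a prime power with $q\ge 1+\binom{n}{k+\mu}$, then there exists an optimal $[n,k,d]_q$ linear code with information $(r,\delta)_c$-locality; that is, there exists an $[n,k,d]_q$ linear code with information $(r,\delta)_c$-locality such that $n = d+k-1+\mu$.
   Context: An $[n,k,d]_q$ linear code is a $k$-dimensional linear subspace $\mathcal{C}\subseteq\mathbb{F}_q^n$ with minimum (Hamming) distance $d$. Let $G=(g_1,\dots,g_n)$ be a $k\times n$ generator matrix of $\mathcal{C}$, with columns $g_i\in\mathbb{F}_q^k$. Write $[n]=\{1,\dots,n\}$; for $N\subseteq[n]$ let $\operatorname{span}(N)$ be the $\mathbb{F}_q$-linear span of $\{g_i: i\in N\}$ and $\operatorname{rank}(N)$ its dimension. A set $I\subseteq[n]$ is an information set if $|I|=\operatorname{rank}(I)=k$. The $i$-th coordinate of $\mathcal{C}$ has $(r,\delta)_c$-locality if there exist $\delta-1$ pairwise disjoint sets $R^{(i)}_1,\dots,R^{(i)}_{\delta-1}\subseteq[n]\setminus\{i\}$ such that for every $1\le\xi\le\delta-1$: $|R^{(i)}_\xi|\le r$ and $g_i\in\operatorname{span}(R^{(i)}_\xi)$. The code $\mathcal{C}$ has information $(r,\delta)_c$-locality if there is an information set $I$ such that every coordinate $i\in I$ has $(r,\delta)_c$-locality. A code with information $(r,\delta)_c$-locality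 is called optimal if $n=d+k-1+\mu$, with $\mu$ as in the claim. *)

(* Defs.v *)
From HB Require Import structures.
From mathcomp Require Import all_boot all_order all_algebra.

Set Implicit Arguments.
Unset Strict Implicit.
Unset Printing Implicit Defensive.

Import Order.TTheory GRing.Theory Num.Theory.

Local Open Scope ring_scope.

Definition ceil_divn (a b : nat) : nat := ((a + b.-1) %/ b)%N.

Lemma ceil_divnE (a b : nat) : (0 < b)%N ->
  (ceil_divn a b)%:Z = Num.ceil (a%:R / b%:R : rat).
Proof.
move=> b0; apply/esym/eqP; rewrite -subr_eq0.
have b0R : (0 : rat) < b%:R by rewrite ltr0n.
rewrite subr_eq0; apply/eqP/ceil_def.
rewrite ltr_pdivlMr // ler_pdivrMr // intrD /= -!pmulrn mulrBl mul1r.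
rewrite ltrBlDr -!natrM -natrD ltr_nat ler_nat /ceil_divn.
have := divn_eq (a + b.-1) b; have := ltn_pmod (a + b.-1) b0.
set x := (_ %/ _ * _)%N; set y := (_ %% _)%N => hy he.
apply/andP; split; first by rewrite -(prednK b0) addnS ltnS he leq_addr.
by rewrite -(leq_add2r b.-1) he leq_add2l -ltnS prednK.
Qed.

(* On naturals: the ceiling is at least 1, so neither subtraction truncates
   once 0 < k, 0 < r and 0 < delta. *)
Definition mu (k r delta : nat) : nat :=
  (ceil_divn ((k - 1) * (delta - 1) + 1) ((r - 1) * (delta - 1) + 1) - 1)%N.

Section Codes.
Variables (F : finFieldType) (n : nat).

Definition hamming_dist (u v : 'rV[F]_n) : nat :=
  #|[set j : 'I_n | u 0 j != v 0 j]|.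

Definition is_min_dist (C : {vspace 'rV[F]_n}) (d : nat) : Prop :=
  (exists u v, [/\ u \in C, v \in C, u != v & hamming_dist u v = d]) /\
  (forall u v, u \in C -> v \in C -> u != v -> (d <= hamming_dist u v)%N).

Definition linear_code (k d : nat) (C : {vspace 'rV[F]_n}) : Prop :=
  \dim C = k /\ is_min_dist C d.

Definition generator_matrix k (C : {vspace 'rV[F]_n}) (G : 'M[F]_(k, n)) : Prop :=
  basis_of C [seq row i G | i : 'I_k].

Definition col_span k (G : 'M[F]_(k, n)) (N : {set 'I_n}) : {vspace 'cV[F]_k} :=
  <<[seq col i G | i in N]>>%VS.

Definition col_rank k (G : 'M[F]_(k, n)) (N : {set 'I_n}) : nat :=
  \dim (col_span G N).

Definition information_set k (G : 'M[F]_(k, n)) (I : {set 'I_n}) : Prop :=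
  #|I| = k /\ col_rank G I = k.

Definition coord_locality k (G : 'M[F]_(k, n)) (r delta : nat) (i : 'I_n) : Prop :=
  exists R : 'I_(delta - 1) -> {set 'I_n},
    (forall xi xi', xi != xi' -> [disjoint R xi & R xi']) /\
    (forall xi, [/\ i \notin R xi, (#|R xi| <= r)%N & col i G \in col_span G (R xi)]).

(* Row operations on G preserve both information sets and locality, so the
   choice of generator matrix is immaterial. *)
Definition information_locality (k r delta : nat) (C : {vspace 'rV[F]_n}) : Prop :=
  exists G : 'M[F]_(k, n), generator_matrix C G /\
    exists I : {set 'I_n}, information_set G I /\
      (forall i, i \in I -> coord_locality G r delta i).

Definition optimal_code (k d r delta : nat) (C : {vspace 'rV[F]_n}) : Prop :=
  [/\ linear_code k d C, information_locality k r delta C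
    & n = (d + k - 1 + mu k r delta)%N].

End Codes.

(* Main.v *)
Require Import Defs.
From HB Require Import structures.
From mathcomp Require Import all_boot all_order all_algebra.
From mathcomp Require Import zify.

(** Let [t = delta - 1].  The [n] coordinates are split into [k] sunflowers, each
    made of a centre and [t] petals of [r] elements.  The words whose value at each
    centre is the sum of the values over each of its petals form a code in which
    every set of coordinates containing no full petal can be prescribed freely.
    There are at most ['C(n, k) <= 'C(n, k + mu) < q] such sets of size [k], so a
    generic [k]-dimensional subcode has all of them as information sets; the
    centres are one, and the petals give locality.  The zero set of a nonzero
    codeword contains the centre of each of its full petals; removing one element
    from each of its [m] full petals leaves at most [k - 1] elements, among them
    the [m (r - 1)] other elements and at least [m / t] centres.  Hence
    [m <= (k - 1) t / ((r - 1) t + 1)], i.e. [m <= mu], and the zero set has at most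
    [k - 1 + mu] elements. *)

Set Implicit Arguments.
Unset Strict Implicit.
Unset Printing Implicit Defensive.

(** * Generic subspaces over a large finite field *)

Section GenericProjection.
Import GRing.Theory.
Local Open Scope ring_scope.
Variable F : finFieldType.

(** Induction on [l]: if [v] is good for the tail but killed by [h a], it serves as a direction from
    some [w] not killed by [h a]. Every point of that line is good for [a], and fewer than [#|F|] of
    them are bad for the tail. *)
Lemma avoid_kernels m (I : eqType) (l : seq I) (s : I -> nat)
    (h : forall i, 'M[F]_(m, s i)) :
    (size l <= #|F|)%N -> {in l, forall i, h i != 0} ->
  exists x : 'rV[F]_m, {in l, forall i, x *m h i != 0}.
Proof.
elim: l => [|a l IHl] /= szl hn0; first by exists 0.
have [i li|v vP] := IHl (ltnW szl).
  by apply: hn0; rewrite inE li orbT.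
have [va0|va0] := eqVneq (v *m h a) 0; last first.
  by exists v => i; rewrite inE => /predU1P[->//|/vP].
have /rowV0Pn[_ /submxP[w ->] wa0] := hn0 a (mem_head _ _).
(* On the line [w + c v] every kernel other than that of [h a] is met at most once. *)
pose bad c i := (w + c *: v) *m h i == 0.
suff /existsP[c /hasPn cP]: [exists c, ~~ has (bad c) l].
  exists (w + c *: v) => i; rewrite inE => /predU1P[->|/cP//].
  by rewrite mulmxDl -scalemxAl va0 scaler0 addr0.
apply: contraTT szl => /existsPn allbad; rewrite -ltnNge ltnS.
have hasbad c : has (bad c) l by have := allbad c; rewrite negbK.
(* If all points were bad, the index of the first kernel met would inject [F] into [size l]
   indices. *)
pose g c := find (bad c) l.
rewrite cardE -(size_map g) -[leqRHS](size_iota 0); apply: uniq_leq_size.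
  rewrite map_inj_uniq ?enum_uniq // => c c' gcc'; apply/eqP/contraT => ncc'.
  have := nth_find a (hasbad c'); have := nth_find a (hasbad c).
  rewrite -/(g c) -/(g c') gcc'; set i := nth a l _.
  have /vP/negP vi : i \in l by rewrite mem_nth // -has_find.
  move=> /eqP e1 /eqP e2; case: vi; move: (subrr (0 : 'rV[F]_(s i))).
  rewrite -{1}e1 -{1}e2 -mulmxBl opprD addrACA subrr add0r -scalerBl -scalemxAl.
  by move/eqP; rewrite scaler_eq0 subr_eq0 (negPf ncc').
by move=> _ /mapP[c _ ->]; rewrite mem_iota /= -has_find.
Qed.

(** The rows of [P] are chosen one by one. Multiplying by [cokermx] tests membership in the row
    space of [P *m M i], whose rank is too small to contain all rows of [M i]. *)
Lemma generic_projection m k (I : finType) (s : I -> nat)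
    (M : forall i, 'M[F]_(m, s i)) :
    (#|I| <= #|F|)%N -> (forall i, (k <= \rank (M i))%N) ->
  exists P : 'M[F]_(k, m), forall i, row_free (P *m M i).
Proof.
move=> cI; elim: k => [|k IHk] rkM.
  by exists 0 => i; rewrite /row_free -leqn0 rank_leq_row.
have [i|P Pfree] := IHk; first exact: ltnW.
have [||x xP] := @avoid_kernels m I (enum I) _ (fun i => M i *m cokermx (P *m M i)).
- by rewrite -cardE.
- move=> i _; rewrite -/(submx _ _) -submxE; apply/negP => /mxrankS.
  apply/negP; rewrite -ltnNge; apply: leq_trans (rkM i).
  by rewrite ltnS rank_leq_row.
exists (col_mx x P : 'M_(1 + k, m)) => i.
apply: (@inj_row_free _ (1 + k)) => v; rewrite -[v]hsubmxK [col_mx x P *m _]mul_col_mx mul_row_col.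
set a := lsubmx v; set b := rsubmx v => abE.
have a0 : a = 0.
  apply: contraNeq (xP i (mem_enum _ _)) => a0; rewrite mulmxA -submxE.
  have aE : a = (a 0 0)%:M by rewrite -mx11_scalar.
  have an0 : a 0 0 != 0 by apply: contraNneq a0 => a0; rewrite aE a0 raddf0.
  move/eqP: abE; rewrite aE mul_scalar_mx addr_eq0 => /eqP abE.
  rewrite -(eqmx_scale _ an0) abE -mulNmx.
  exact: submxMl.
move: abE; rewrite a0 mul0mx add0r => bE.
by rewrite (row_free_inj (Pfree i) (etrans bE (esym (mul0mx _ _)))) row_mx0.
Qed.

End GenericProjection.

(** * Arithmetic of [mu], binomials and subsets *)

Lemma mu_floor k r delta :
  mu k r delta = ((k - 1) * (delta - 1)) %/ ((r - 1) * (delta - 1) + 1).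
Proof.
rewrite /mu /ceil_divn; set a := (k - 1) * _; set b := (r - 1) * _ + 1.
have b0 : 0 < b by rewrite /b addn1.
by rewrite -addnA add1n prednK // divnDr ?dvdnn // divnn b0 addnK.
Qed.

(** Binomials grow up to the middle; beyond it, symmetry replaces [j] by [n - j], which is still at
    least [k]. *)
Lemma leq_bin_center n k j : k <= j -> j <= n - k -> 'C(n, k) <= 'C(n, j).
Proof.
have leq_bin_half i : k <= i -> i.*2 <= n -> 'C(n, k) <= 'C(n, i).
  elim: i => [|i IHi]; first by rewrite leqn0 => /eqP->.
  rewrite leq_eqVlt => /predU1P[->//|ki] le_i; apply: (leq_trans (IHi _ _)); try lia.
  rewrite -(leq_pmul2l (ltn0Sn i)) mul_bin_left leq_mul2r; apply/orP; right; lia.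
move=> kj jnk; have [?|?] := leqP j.*2 n; first exact: leq_bin_half.
rewrite -(@bin_sub n j); last by lia.
apply: leq_bin_half; lia.
Qed.

Lemma subset_of_card (T : finType) (B : {set T}) k : k <= #|B| ->
  exists2 A : {set T}, A \subset B & #|A| = k.
Proof.
move=> kB; exists [set x in take k (enum B)].
  by apply/subsetP => x; rewrite inE => /mem_take; rewrite mem_enum.
rewrite cardsE; have /card_uniqP-> := take_uniq k (enum_uniq B).
by rewrite size_take_min -cardE; apply/minn_idPl.
Qed.

(** * Sunflowers and words with petal sums *)

Section Sunflowers.
Import GRing.Theory.
Local Open Scope ring_scope.
Variables (V P L : finType) (ctr : P -> V).
(* [inl v] is a centre, and [inr (p, l)] the [l]-th element of the petal [p], which
   is attached to the centre [ctr p]. *)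
Notation T := (V + P * L)%type.

Definition flower (W : {set V}) (Q : {set P}) (K : {set L}) : {set T} :=
  (inl @: W) :|: (inr @: setX Q K).

Definition has_petal (Z : {set T}) (p : P) : bool :=
  [forall l, inr (p, l) \in Z].

Lemma in_flowerl W Q K v : (inl v \in flower W Q K) = (v \in W).
Proof.
rewrite inE mem_imset; last by move=> ? ? [].
by rewrite orbC; case: imsetP => [[]|].
Qed.

Lemma in_flowerr W Q K p l : (inr (p, l) \in flower W Q K) = (p \in Q) && (l \in K).
Proof.
rewrite inE [X in _ || X]mem_imset; last by move=> ? ? [].
by rewrite in_setX; case: imsetP => [[]|].
Qed.

Lemma card_flower W Q K : #|flower W Q K| = (#|W| + #|Q| * #|K|)%N.
Proof.
have -> : flower W Q K = (inl @: W) :|: (inr @: setX Q K) by [].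
have I0 : [disjoint inl @: W & (inr @: setX Q K : {set T})].
  by apply/pred0P => -[v|x] /=; apply/andP => -[] /imsetP[? ? //] _ /imsetP[].
by rewrite cardsU (disjoint_setI0 I0) cards0 subn0 !card_imset ?cardsX // => ? ? [].
Qed.

(* Remove one element from each petal contained in [Z]; closedness leaves the
   centres of these petals in [B]. *)
Lemma petal_free_core (t : nat) (l0 : L) (Z : {set T}) :
    (forall v, #|[set p | ctr p == v]| <= t)%N ->
    (forall p, has_petal Z p -> inl (ctr p) \in Z) ->
  exists B : {set T}, [/\ B \subset Z, forall p, ~~ has_petal B p
    & (#|Z| <= #|B| + (#|B| * t) %/ ((#|L| - 1) * t + 1))%N].
Proof.
move=> fib Zc; pose Q := [set p | has_petal Z p].
pose X := flower set0 Q [set l0].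
have XZ : X \subset Z.
  apply/subsetP => -[v|[p l]]; first by rewrite in_flowerl inE.
  by rewrite in_flowerr !inE => /andP[/forallP/(_ l)].
exists (Z :\: X); split; first exact: subsetDl.
  move=> p; apply/negP => /forallP pB; have := pB l0; rewrite in_setD in_flowerr !inE eqxx.
  case/andP; rewrite andbT => /forallP[] l.
  by have := pB l; rewrite inE => /andP[].
rewrite -(cardsID X Z) (setIidPr XZ) addnC leq_add2l card_flower cards0 cards1 muln1.
rewrite add0n leq_divRL ?addn1 // mulnS.
have: flower (ctr @: Q) Q [set~ l0] \subset Z :\: X.
  apply/subsetP => -[v|[p l]].
    rewrite in_setD !in_flowerl inE /= => /imsetP[p].
    by rewrite inE => /Zc pZ ->.
  rewrite in_setD !in_flowerr !inE negb_and => /andP[/forallP/(_ l)->->].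
  by rewrite orbT.
move=> /subset_leq_card; rewrite card_flower cardsC1 -subn1.
(* Each centre carries at most [t] petals, so at least [#|Q| / t] centres remain. *)
have: (#|Q| <= #|ctr @: Q| * t)%N.
  rewrite -sum1_card (partition_big ctr (mem (ctr @: Q))) /=; last first.
    by move=> p pQ; apply: imset_f.
  rewrite -sum_nat_const; apply: leq_sum => v _; apply: leq_trans (fib v).
  rewrite sum1_card; apply: subset_leq_card; apply/subsetP => p.
  by rewrite !inE unfold_in /= => /andP[].
nia.
Qed.

Variable F : finFieldType.

Definition petal_sums (c : T -> F) : Prop :=
  forall p, c (inl (ctr p)) = \sum_l c (inr (p, l)).

(** Each petal has an element outside [B]; correcting [v] there alone repairs its sum, and distinct
    petals do not interfere. *)
Lemma petal_sums_extension (B : {set T}) (v : T -> F) :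
    (forall p, ~~ has_petal B p) ->
  exists2 c, petal_sums c & {in B, c =1 v}.
Proof.
move=> nB; have exl p : [exists l, inr (p, l) \notin B].
  by have := nB p; rewrite negb_forall.
pose free p := xchoose (existsP (exl p)).
exists (fun x => match x with
  | inl w => v x
  | inr (p, l) => if l == free p
      then v (inl (ctr p)) - \sum_(l' | l' != free p) v (inr (p, l')) else v x
  end).
  move=> p; rewrite (bigD1 (free p)) //= eqxx [X in _ + X](eq_bigr (fun l => v (inr (p, l)))).
    by rewrite subrK.
  by move=> l /negPf->.
move=> [//|[p l]] plB; case: eqP => // lE.
by have := xchooseP (existsP (exl p)); rewrite -/(free p) -lE plB.
Qed.

(** The words with petal sums restrict onto every petal-free [B], and there are few enough such [B]
    of size [k] for [generic_projection] to serve all of them at once. *)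
Lemma generic_petal_sums n k (f : T -> 'I_n) : bijective f ->
    ('C(#|{: T}|, k) <= #|F|)%N ->
  exists G : 'M[F]_(k, n),
    (forall u : 'rV_k, petal_sums (fun x => (u *m G) 0 (f x))) /\
    (forall B : {set T}, #|B| = k -> (forall p, ~~ has_petal B p) ->
      row_free (colsub (fun j : 'I_#|B| => f (enum_val j)) G)).
Proof.
case=> e fK eK bnd.
(* Parity-check matrix: column [j] is the equation of the [j]-th petal. *)
pose H : 'M[F]_(n, #|P|) := \matrix_(i, j)
  match e i with
  | inl v => (v == ctr (enum_val j))%:R
  | inr (p, _) => - (p == enum_val j)%:R
  end.
have HE (x : 'rV_n) j : (x *m H) 0 j =
    x 0 (f (inl (ctr (enum_val j)))) - \sum_l x 0 (f (inr (enum_val j, l))).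
  rewrite mxE (reindex f) /=; last by exists e => ? _.
  rewrite big_sumType /= (bigD1 (ctr (enum_val j))) //= mxE fK eqxx mulr1.
  rewrite big1 ?addr0 => [|v /negPf nv]; last by rewrite mxE fK nv mulr0.
  congr (_ + _); transitivity (\sum_p \sum_l x 0 (f (inr (p, l))) * H (f (inr (p, l))) j).
    by rewrite pair_bigA; apply: eq_bigr => -[].
  rewrite (bigD1 (enum_val j)) //= [X in _ + X]big1 ?addr0 => [|p /negPf np].
    by rewrite -sumrN; apply: eq_bigr => l _; rewrite mxE fK eqxx mulrN1.
  by apply: big1 => l _; rewrite mxE fK np oppr0 mulr0.
have HP (x : 'rV_n) : x *m H = 0 <-> petal_sums (fun y => x 0 (f y)).
  split=> [x0 p|xP].
    have := HE x (enum_rank p); rewrite x0 mxE enum_rankK => /esym/eqP.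
    by rewrite subr_eq0 => /eqP.
  by apply/rowP => j; rewrite HE (xP (enum_val j)) subrr mxE.
pose good (B : {set T}) := (#|B| == k) && [forall p, ~~ has_petal B p].
pose cols (B : {set T}) (j : 'I_#|B|) := f (enum_val j).
have [||G0 G0P] := @generic_projection F n k {B | good B}
    (fun B => #|val B|) (fun B => colsub (@cols (val B)) (kermx H)).
- rewrite card_sig; apply: leq_trans bnd; rewrite -card_draws.
  apply: subset_leq_card; apply/subsetP => B; rewrite !inE.
  by case/andP.
- move=> [B /= /andP[/eqP Bk /forallP nB]].
  have ex u : exists x : 'rV_n, x *m H == 0 /\
      forall w : 'I_#|B|, x 0 (cols B w) = (u == w)%:R.
    have [c cP cB] := petal_sums_extension (fun y => (enum_val u == y)%:R) nB.
    exists (\row_i c (e i)); split.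
      apply/eqP/HP => p; rewrite mxE fK cP; apply: eq_bigr => l _.
      by rewrite mxE fK.
    by move=> w; rewrite mxE fK cB ?enum_valP // (inj_eq enum_val_inj).
  (* The rows of [X] are words of the kernel restricting to the unit vectors on [B]; factoring [X]
     through [kermx H] bounds the rank below. *)
  have [X XP] : exists X : 'M[F]_(#|B|, n), X *m H = 0 /\ colsub (@cols B) X = 1%:M.
    have /fin_all_exists[x xP] := ex.
    exists (\matrix_u x u); split; apply/row_matrixP => u.
      by rewrite row_mul rowK row0; apply/eqP; case: (xP u).
    by apply/rowP => w; rewrite !mxE; case: (xP u).
  case: XP => /sub_kermxP/submxP[Y ->]; rewrite -mulmx_colsub => Y1.
  by apply: leq_trans (mxrankM_maxr Y _); rewrite Y1 mxrank1 Bk.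
exists (G0 *m kermx H); split=> [u|B Bk nB].
  by apply/HP; rewrite -mulmxA -(mulmxA G0) mulmx_ker !mulmx0.
have gB : good B by rewrite /good Bk eqxx; apply/forallP.
by rewrite -mulmx_colsub; apply: (G0P (exist _ B gB)).
Qed.
End Sunflowers.

(** * Codes spanned by the rows of a matrix *)

Section RowSpaceCode.
Import GRing.Theory.
Local Open Scope ring_scope.
Variables (F : finFieldType) (n k : nat) (G : 'M[F]_(k, n)).

Definition row_code : {vspace 'rV[F]_n} := <<[seq row i G | i : 'I_k]>>%VS.

Lemma row_code_rows : [seq row i G | i : 'I_k] = [tuple row i G | i < k].
Proof. by rewrite /image_mem /= -val_ord_tuple. Qed.

Lemma row_codeP x : reflect (exists u : 'rV_k, x = u *m G) (x \in row_code).
Proof.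
apply: (iffP idP) => [|[u ->]].
  rewrite /row_code row_code_rows => /coord_span xE.
  exists (\row_i coord [tuple row i G | i < k] i x); rewrite mulmx_sum_row {1}xE.
  by apply: eq_bigr => i _; rewrite mxE -tnth_nth tnth_mktuple.
rewrite mulmx_sum_row; apply: memv_suml => i _; apply: memvZ.
by apply: memv_span; apply: image_f.
Qed.

Lemma row_code_generator : row_free G -> generator_matrix row_code G.
Proof.
move=> Gfree; rewrite /generator_matrix basisEfree subvv dim_span !andbT.
rewrite row_code_rows; apply/freeP => c c0 i.
have : \row_i c i *m G = 0.
  rewrite mulmx_sum_row -[RHS]c0; apply: eq_bigr => j _.
  by rewrite mxE -tnth_nth tnth_mktuple.
rewrite -(mul0mx _ G) => /(row_free_inj Gfree)/rowP/(_ i).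
by rewrite !mxE.
Qed.

Lemma col_span_full s (g : 'I_s -> 'I_n) (N : {set 'I_n}) :
  (forall j, g j \in N) -> row_free (colsub g G) -> col_span G N = fullv.
Proof.
move=> gN /row_freeP[X GX1]; apply/vspaceP => y; rewrite memvf.
rewrite -[y]mul1mx -GX1 -mulmxA.
have -> : colsub g G *m (X *m y) = \sum_j (X *m y) j 0 *: col (g j) G.
  apply/colP => i; rewrite summxE mxE; apply: eq_bigr => j _.
  by rewrite !mxE mulrC.
apply: memv_suml => j _; apply: memvZ; apply: memv_span.
exact: image_f.
Qed.

Definition zeros (u : 'rV[F]_k) : {set 'I_n} := [set j | (u *m G) 0 j == 0].

(** By linearity, two codewords agree exactly on the zeros of their difference. *)
Lemma row_code_min_dist z : row_free G ->
    (forall u : 'rV_k, u != 0 -> (#|zeros u| <= z)%N) ->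
    (exists2 u : 'rV_k, u != 0 & (z <= #|zeros u|)%N) ->
  is_min_dist row_code (n - z).
Proof.
move=> Gfree ub [u0 u0n0 lb].
have dist u v : hamming_dist (u *m G) (v *m G) = (n - #|zeros (u - v)|)%N.
  rewrite -[X in (X - _)%N]card_ord -(cardC (mem (zeros (u - v)))) addKn.
  rewrite /hamming_dist cardsE; apply: eq_card => j.
  by rewrite !inE unfold_in mulmxBl [in RHS]mxE [X in _ + X]mxE subr_eq0.
split.
  exists (u0 *m G), (0 *m G); split; try by apply/row_codeP; eexists.
    by rewrite (inj_eq (row_free_inj Gfree)).
  by rewrite dist subr0; congr (_ - _)%N; apply/eqP; rewrite eqn_leq ub.
move=> _ _ /row_codeP[u ->] /row_codeP[v ->].
rewrite (inj_eq (row_free_inj Gfree)) -subr_eq0 dist => /ub.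
exact: leq_sub2l.
Qed.

End RowSpaceCode.

(** * Construction of the optimal code *)

Theorem theorem2 (k r delta n q : nat) (F : finFieldType)
    (hr : 2 <= r) (hdelta : 2 <= delta) (hrk : r < k)
    (hn : n = k * (r * (delta - 1) + 1))
    (hF : #|F| = q)
    (hq : 1 + 'C(n, k + mu k r delta) <= q) :
  exists (d : nat) (C : {vspace 'rV[F]_n}), optimal_code k d r delta C.
Proof.
have muE := leq_trunc_div ((k - 1) * (delta - 1)) ((r - 1) * (delta - 1) + 1).
rewrite -mu_floor in muE.
have mu_floorE := mu_floor k r delta.
rewrite /optimal_code; set m := mu k r delta in hq muE mu_floorE *.
have t0 : 0 < delta - 1 by lia.
set t := delta - 1 in hn muE mu_floorE t0.
have m_le : m * (r - 1) <= k - 1 by rewrite -(leq_pmul2r t0); nia.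
have m_lt : m <= k - 1 by nia.
(* Together with [m_lt] this gives [k + m <= n - k], as [leq_bin_center] requires. *)
have n_ge : 3 * k <= n by rewrite hn; nia.
pose T : finType := ('I_k + 'I_k * 'I_t * 'I_r)%type.
have cT : #|T| = n by rewrite card_sum !card_prod !card_ord hn; nia.
pose f (x : T) : 'I_n := cast_ord cT (enum_rank x).
have f_bij : bijective f.
  exists (fun j => enum_val (cast_ord (esym cT) j)) => [x|j].
    by rewrite /f cast_ordK enum_rankK.
  by rewrite /f enum_valK cast_ordKV.
have f_inj := bij_inj f_bij.
pose l0 : 'I_r := Ordinal (ltnW hr).
have [|G [Gsum Gfree]] := @generic_petal_sums _ _ _ (@fst 'I_k 'I_t) F n k f f_bij.
  rewrite cT hF; apply: leq_trans hq; apply: leqW.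
  by apply: leq_bin_center; lia.
(* The centres, the future information set, contain no full petal because petals are nonempty. *)
pose B0 : {set T} := flower [set: 'I_k] set0 set0.
have B0k : #|B0| = k by rewrite card_flower cards0 mul0n addn0 cardsT card_ord.
have B0free : row_free (colsub (fun j : 'I_#|B0| => f (enum_val j)) G).
  apply: Gfree => // p; apply/negP => /forallP/(_ l0).
  by rewrite in_flowerr !inE.
have Grow : row_free G.
  apply: inj_row_free => v vG; apply: (row_free_inj B0free).
  by rewrite mul0mx mulmx_colsub vG; apply/rowP => j; rewrite !mxE.
pose Z u := f @^-1: zeros G u.
have card_Z u : #|Z u| = #|zeros G u|.
  by rewrite /Z on_card_preimset //; case: f_bij => e fK eK; exists e => x _.
have Zclosed u p : has_petal (Z u) p -> inl p.1 \in Z u.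
  move=> /forallP pZ; rewrite !inE (Gsum u p) big1 // => l _.
  by apply/eqP; have := pZ l; rewrite !inE.
have small (B : {set T}) u : u != 0%R -> B \subset Z u ->
    (forall p, ~~ has_petal B p) -> #|B| <= k - 1.
  move=> u0 BZ nB; rewrite leqNgt; apply/negP => kB.
  have [|A AB Ak] := @subset_of_card _ B k; first lia.
  case/eqP: u0; apply: (row_free_inj (Gfree A Ak _)) => [p|].
    apply: contra (nB p) => /forallP pA; apply/forallP => l.
    exact: (subsetP AB).
  rewrite mul0mx mulmx_colsub; apply/rowP => j; rewrite mxE [RHS]mxE; apply/eqP.
  by have /(subsetP AB)/(subsetP BZ) := enum_valP j; rewrite !inE.
have ub u : u != 0%R -> #|zeros G u| <= k - 1 + m.
  move=> u0; rewrite -card_Z.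
  have [v||B [BZ nB]] := @petal_free_core _ _ _ (@fst 'I_k 'I_t) t l0 (Z u).
  - rewrite (_ : [set _ | _] = setX [set v] setT); last first.
      by apply/setP => p; rewrite !inE andbT.
    by rewrite cardsX cards1 mul1n cardsT card_ord.
  - exact: Zclosed.
  move/leq_trans; apply; rewrite card_ord mu_floorE.
  have Bk := small B u u0 BZ nB.
  by apply: leq_add => //; apply: leq_div2r; rewrite leq_mul2r Bk orbT.
(* Equality: [c] centres and [m] petals attached to them, minus one element of
   each petal, form a set of [k - 1] coordinates, on which some nonzero codeword
   vanishes; it then vanishes on the [m] removed elements as well. *)
pose c := k - 1 - m * (r - 1).
have [|W _ Wc] := @subset_of_card _ [set: 'I_k] c.
  by rewrite cardsT card_ord (leq_trans (leq_subr _ _)) ?leq_subr.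
(* The [c] centres carry enough petals: [m <= c * t] is a rearrangement of [muE]. *)
have [|Q QW Qm] := @subset_of_card _ (setX W [set: 'I_t]) m.
  by rewrite cardsX cardsT card_ord Wc /c -(leq_pmul2l t0); nia.
pose S := flower W Q [set~ l0].
have Sk : #|S| = k - 1.
  by rewrite card_flower cardsC1 card_ord Wc Qm -subn1 /c subnK.
have lb : exists2 u, u != 0%R & k - 1 + m <= #|zeros G u|.
  pose GS := colsub (fun j : 'I_#|S| => f (enum_val j)) G.
  have /rowV0Pn[u /sub_kermxP uS u0] : kermx GS != 0%R.
    rewrite kermx_eq0 /row_free neq_ltn (leq_ltn_trans (rank_leq_col _)) //.
    by rewrite Sk; lia.
  exists u => //; rewrite -card_Z.
  have SZ : S \subset Z u.
    apply/subsetP => x xS; rewrite !inE.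
    move/rowP/(_ (enum_rank_in xS x)): uS.
    by rewrite mulmx_colsub mxE enum_rankK_in // => ->; rewrite mxE.
  have : flower W Q [set: 'I_r] \subset Z u.
    apply/subsetP => -[w|[p l]].
      by rewrite in_flowerl => wW; apply: (subsetP SZ); rewrite in_flowerl.
    rewrite in_flowerr => /andP[pQ _].
    have Zl l' : l' != l0 -> inr (p, l') \in Z u.
      by move=> ll0; apply: (subsetP SZ); rewrite in_flowerr pQ !inE.
    have [->{l}|/Zl//] := eqVneq l l0.
    have : inl p.1 \in Z u.
      apply: (subsetP SZ); rewrite in_flowerl.
      by have := subsetP QW p pQ; rewrite inE => /andP[].
    rewrite !inE (Gsum u p) (bigD1 l0) //= big1 ?GRing.addr0 // => l /Zl.
    by rewrite !inE => /eqP.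
  move/subset_leq_card; apply: leq_trans.
  rewrite card_flower cardsT card_ord Wc Qm /c; nia.
have rcb := row_code_generator Grow.
exists (n - (k - 1 + m)), (row_code G); split.
- split; last exact: row_code_min_dist.
  by rewrite (size_basis rcb) card_ord.
- exists G; split=> //; exists (f @: B0); split.
    rewrite /information_set card_imset // B0k /col_rank; split=> //.
    rewrite (col_span_full _ B0free) => [|j]; last by rewrite imset_f ?enum_valP.
    by rewrite dimvf /dim /= muln1.
  move=> _ /imsetP[[v _|x xB] ->]; last first.
    by case: x xB => p l; rewrite in_flowerr inE.
  exists (fun j => f @: (inr @: setX [set (v, j)] [set: 'I_r])); split=> [j j' jj'|j].
    apply/pred0P => x /=; apply/andP => -[/imsetP[_ /imsetP[[p l] pl ->] ->]].
    case/imsetP => _ /imsetP[[p' l'] pl' ->] /f_inj [pp' _].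
    move: pl pl' jj'; rewrite !inE !andbT /= pp' => /eqP-> /eqP[->].
    by rewrite eqxx.
  split.
  + by apply/imsetP => -[_ /imsetP[y _ ->] /f_inj].
  + apply: leq_trans (leq_imset_card _ _) _; apply: leq_trans (leq_imset_card _ _) _.
    by rewrite cardsX cards1 mul1n cardsT card_ord.
  (* The petal-sum relation for the rows of [G], read entry by entry. *)
  + have -> : col (f (inl v)) G = (\sum_l col (f (inr (v, j, l))) G)%R.
      apply/colP => i; rewrite summxE mxE.
      have := Gsum (delta_mx 0%R i) (v, j); rewrite -rowE mxE => ->.
      by apply: eq_bigr => l _; rewrite !mxE.
    apply: memv_suml => l _; apply: memv_span; apply: image_f.
    by do 2!apply: imset_f; rewrite !inE eqxx.
(* The subtraction in [d] does not truncate, by [n_ge] and [m_lt]. *)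
lia.
Qed.
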